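(* Let $N\geq 2$ and $P(X)=X^N-\sum_{j=1}^N b_jX^{N-j}$ be a silver polynomial, with companion matrix \[ U=\begin{pmatrix} b_1&b_2&\cdots&b_{N-1}&b_N\\ 1&0&\cdots&0&0\\ 0&1&\ddots&&\vdots\\ \vdots&&\ddots&0&0\\ 0&\cdots&0&1&0\end{pmatrix}. \] (1) $U$ is primitive if and only if the indices $j\in\{1,\dots,N\}$ with $b_j=1$ have no common divisor greater than $1$. (2) $U$ is not primitive if and only if there exist an integer $d>1$ and a silver polynomial $Q$ whose companion matrix (of the same form) is primitive, such that $P(X)=Q(X^d)$. In this case, if $\sigma$ is the silver number of $P$, then $\sigma^d$ is the silver number of $Q$ (so $\sigma^d$ is a silver number), and $P$ has more than one root of modulus $>1$.
   Context: A silver polynomial of degree $N\geq2$ is $X^N-\sum_{j=1}^Nb_jX^{N-j}$ with all $b_j\in\{0,1\}$, $b_N=1$ and $\sum_j b_j>1$. Its silver number is its largest positive real root. A non-negative real square matrix $A$ is primitive if some positive power $A^m$ has all entries strictly positive. *)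

(* Defs.v *)
From HB Require Import structures.
From mathcomp Require Import all_boot all_order all_algebra.
From mathcomp Require Import polyrcf complex reals.
Set Implicit Arguments.
Unset Strict Implicit.
Unset Printing Implicit Defensive.
Import Order.TTheory GRing.Theory Num.Theory.
Local Open Scope ring_scope.

(* Coefficient families are 1-indexed functions b : nat -> bool, of which only
   the values b 1, ..., b N matter. *)
Definition silver (N : nat) (b : nat -> bool) : bool :=
  [&& (2 <= N)%N, b N & (1 < \sum_(1 <= j < N.+1) b j)%N].

Definition silver_poly (R : nzRingType) (N : nat) (b : nat -> bool) : {poly R} :=
  'X^N - \sum_(1 <= j < N.+1) (b j)%:R *: 'X^(N - j).

(* Rows and columns are 0-indexed, so the first row holds b_1, ..., b_N. *)
Definition silver_companion (R : nzRingType) (N : nat) (b : nat -> bool) :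
    'M[R]_N :=
  \matrix_(i < N, j < N)
    if (i == 0 :> nat)%N then (b j.+1)%:R else (i == j.+1 :> nat)%:R.

Definition primitive_mx (R : numDomainType) (n : nat) (A : 'M[R]_n) : Prop :=
  (forall i j, 0 <= A i j) /\
  exists2 m : nat, (0 < m)%N & forall i j, 0 < (A ^+ m) i j.

Definition largest_pos_root (R : numDomainType) (p : {poly R}) (s : R) : Prop :=
  [/\ 0 < s, root p s & forall x : R, 0 < x -> root p x -> x <= s].

Definition silver_number (R : numDomainType) (s : R) : Prop :=
  exists (N : nat) (b : nat -> bool),
    silver N b /\ largest_pos_root (silver_poly R N b) s.

Lemma silver_number_exists (R : rcfType) (N : nat) (b : nat -> bool) :
  silver N b -> exists s : R, largest_pos_root (silver_poly R N b) s.
Proof.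
case/and3P=> N2 bN sb; set p := silver_poly R N b.
have hE x : p.[x] = x ^+ N - \sum_(1 <= j < N.+1) (b j)%:R * x ^+ (N - j).
  rewrite /p /silver_poly !hornerE horner_sum; congr (_ - _).
  by apply: eq_bigr => j _; rewrite !hornerE.
have p1 : p.[1] < 0.
  rewrite hE expr1n subr_lt0 (eq_bigr (fun j => (b j : nat)%:R)).
    by rewrite -natr_sum ltr1n.
  by move=> j _; rewrite expr1n mulr1.
have p2 : 0 <= p.[2].
  rewrite hE subr_ge0; apply: (@le_trans _ _ (\sum_(1 <= j < N.+1) 2 ^+ (N - j))).
    by apply: ler_sum => j _; case: (b j); rewrite ?mul1r ?mul0r ?exprn_ge0.
  elim: N {N2 bN sb p hE p1} => [|n IH]; first by rewrite big_geq.
  rewrite big_nat_recl //= subn1 /= -[X in _ + X](_ : \sum_(1 <= j < n.+1) 2 ^+ (n - j) = _).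
    by rewrite exprS mulr_natl mulr2n lerD2l.
  by apply: eq_bigr.
have p12 : p.[1] <= 0 <= p.[2] by rewrite (ltW p1).
have [x0 /andP[x0ge _] rx0] := poly_ivt (ler1n _ 2) p12.
have x0gt : 0 < x0 by apply: lt_le_trans x0ge.
have pn0 : p != 0 by apply: contraTneq p1 => ->; rewrite horner0 ltxx.
have memR x : (x \in rootsR p) = root p x.
  by rewrite -(roots_on_rootsR pn0) in_itv.
have [s [ss [s0 rs]]] : exists s : R,
    (forall x, x \in rootsR p -> x <= s) /\ (0 < s /\ root p s).
  have : {subset rootsR p <= root p} by move=> x; rewrite memR.
  elim: (rootsR p) => [|y l IH] sub; first by exists x0.
  have [s [ms [s0 rs]]] := IH (fun x xl => sub x (mem_behead (s := y :: l) xl)).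
  have [ys|sy] := leP y s.
    by exists s; split=> // x; rewrite inE => /orP[/eqP->//|/ms].
  exists y; split; last by split; [exact: lt_trans sy|apply: sub; exact: mem_head].
  by move=> x; rewrite inE => /orP[/eqP->//|/ms xs]; exact: ltW (le_lt_trans xs sy).
by exists s; split=> // x _ rx; apply: ss; rewrite memR.
Qed.

(* Main.v *)
Require Import Defs.
From HB Require Import structures.
From mathcomp Require Import all_boot all_order all_algebra.
From mathcomp Require Import polyrcf complex reals.
Set Implicit Arguments.
Unset Strict Implicit.
Unset Printing Implicit Defensive.
Import Order.TTheory GRing.Theory Num.Theory.
Local Open Scope ring_scope.

(** The entry (i, j) of U^m is positive iff the graph with edges i -> i - 1
    (for i > 0) and 0 -> j - 1 (for b_j = 1) has a walk of length m from i to j.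
    Let g be the gcd of the indices j with b_j = 1. The lengths of the loops at
    0 form the additive monoid generated by these indices, which contains all
    large multiples of g; every vertex reaches 0 and is reached from 0, so U is
    primitive if g = 1. Conversely every edge decreases the vertex by 1 modulo
    g, so a walk from i to j determines its length modulo g, and U is not
    primitive if g > 1.

    In that case P = Q(X^g), where Q has the coprime indices j / g. Positive
    roots of P and Q correspond under x |-> x^g. A positive root s of a silver
    polynomial exceeds 1, and if w <> 1 satisfies w^g = 1, then s w is a second
    root of P of modulus s. *)

Lemma modn_mul_solvable a g n : (0 < g)%N -> (gcdn g a %| n)%N ->
  exists2 u, (u < g)%N & u * a = n %[mod g].
Proof.
move=> g0 /dvdnP[q ->]; have [v _ /dvdnP[k vE]] := Bezoutl a g0.
exists ((q * v * g.-1) %% g)%N; first by rewrite ltn_mod.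
(* v a = - gcd(g, a) modulo g, and g - 1 stands for -1 *)
rewrite modnMml; apply/eqP; rewrite -(eqn_modDr (q * (v * a))) -mulnDr vE.
have -> : (q * v * g.-1 * a + q * (v * a) = q * v * a * g)%N.
  by rewrite -[in RHS](prednK g0) mulnS addnC mulnA (mulnAC _ a).
by rewrite mulnA !modnMl.
Qed.

Section AdditiveMonoid.
Variable S : nat -> Prop.
Hypotheses (S0 : S 0) (SD : forall m n, S m -> S n -> S (m + n)%N).

Lemma addn_closed_mul k n : S n -> S (k * n)%N.
Proof. by move=> Sn; elim: k => // k IHk; rewrite mulSn; apply: SD. Qed.

Definition contains_large_multiples g : Prop :=
  exists K, forall n, (K <= n)%N -> (g %| n)%N -> S n.

Lemma contains_large_multiples_gcd a g :
  S a -> contains_large_multiples g -> contains_large_multiples (gcdn a g).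
Proof.
move=> Sa [K SK]; have [->|g0] := posnP g.
  by exists 0%N => n _; rewrite gcdn0 => /dvdnP[k ->]; apply: addn_closed_mul.
exists (K + g * a)%N => n Kn; rewrite gcdnC => /(modn_mul_solvable g0)[u ug un].
have uK : (u * a + K <= n)%N.
  by rewrite addnC (leq_trans _ Kn) // leq_add2l leq_mul2r ltnW ?orbT.
have un_le : (u * a <= n)%N by apply: leq_trans (leq_addr _ _) uK.
rewrite -(subnKC un_le); apply: SD; first exact: addn_closed_mul.
by apply: SK; rewrite ?leq_subRL // -eqn_mod_dvd // un.
Qed.

Lemma contains_large_multiples_biggcd (I : Type) (r : seq I) (Q : pred I)
    (F : I -> nat) : (forall i, Q i -> S (F i)) ->
  contains_large_multiples (\big[gcdn/0%N]_(i <- r | Q i) F i).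
Proof.
move=> SF; apply: big_rec => [|i g Qi]; last first.
  exact/contains_large_multiples_gcd/SF.
by exists 0%N => n _; rewrite dvd0n => /eqP->.
Qed.

End AdditiveMonoid.

Lemma expmxS_neq0 (R : pzSemiRingType) n (A : 'M[R]_n) m i j :
  (A ^+ m.+1) i j != 0 -> exists2 k, A i k != 0 & (A ^+ m) k j != 0.
Proof.
move=> Aij; apply/exists_inP; apply: contraNT Aij => /exists_inPn A0.
rewrite exprS mxE big1 // => k _.
have [->|/A0/negPn/eqP->] := eqVneq (A i k) 0; first by rewrite mul0r.
by rewrite mulr0.
Qed.

Definition graded_mx (R : nmodType) n (d : nat) (f : 'I_n -> nat)
    (A : 'M[R]_n) : Prop :=
  forall i k, A i k != 0 -> f i = (f k).+1 %[mod d].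

Lemma expmx_graded (R : pzSemiRingType) n d f (A : 'M[R]_n) m i j :
  graded_mx d f A -> (A ^+ m) i j != 0 -> f i = f j + m %[mod d].
Proof.
move=> grading; elim: m i j => [|m IHm] i j.
  by rewrite expr0 mxE addn0; have [->//|] := eqVneq i j; rewrite eqxx.
case/expmxS_neq0=> k /grading-> /IHm kj.
by rewrite -addn1 -modnDml kj modnDml addn1 addnS.
Qed.

Lemma primitive_graded_mx (R : numDomainType) n d f (A : 'M[R]_n.+1) :
  primitive_mx A -> graded_mx d f A -> d = 1%N.
Proof.
case=> _ [[//|m] _ Am] grading.
have f_period k : f k + m.+1 = f ord0 %[mod d].
  by rewrite (expmx_graded grading (lt0r_neq0 (Am ord0 k))).
have [k /grading f0k _] := expmxS_neq0 (lt0r_neq0 (Am ord0 ord0)).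
have : f k + m.+1 + 1 == f k + m.+1 + 0 %[mod d].
  by rewrite addn0 addnAC addn1 -modnDml -f0k modnDml !f_period.
by rewrite eqn_modDl mod0n -[_ == _]/(d %| 1)%N dvdn1 => /eqP.
Qed.

Section NonnegativeMatrix.
Variables (R : numDomainType) (n : nat) (A : 'M[R]_n).
Hypothesis A_ge0 : forall i j, 0 <= A i j.

Lemma expmx_ge0 m i j : 0 <= (A ^+ m) i j.
Proof.
elim: m i j => [|m IHm] i j; first by rewrite expr0 mxE ler0n.
by rewrite exprS mxE sumr_ge0 // => k _; rewrite mulr_ge0.
Qed.

Lemma expmx_gt0D m1 m2 k i j :
  0 < (A ^+ m1) i k -> 0 < (A ^+ m2) k j -> 0 < (A ^+ (m1 + m2)) i j.
Proof.
move=> ik kj; rewrite exprD mxE (bigD1 k) //= ltr_pwDl ?mulr_gt0 //.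
by rewrite sumr_ge0 // => l _; rewrite mulr_ge0 ?expmx_ge0.
Qed.

Lemma primitive_mx_coprime_loops (o : 'I_n) (I : Type) (r : seq I) (Q : pred I)
    (F : I -> nat) :
  (forall i, exists m, 0 < (A ^+ m) i o) ->
  (forall j, exists m, 0 < (A ^+ m) o j) ->
  (forall i, Q i -> 0 < (A ^+ F i) o o) ->
  (\big[gcdn/0]_(i <- r | Q i) F i = 1)%N ->
  primitive_mx A.
Proof.
move=> /fin_all_exists[p toO] /fin_all_exists[q fromO] loops gcd1.
pose S m := 0 < (A ^+ m) o o.
have [||K] := @contains_large_multiples_biggcd S _ _ _ r _ _ loops.
- by rewrite /S expr0 mxE eqxx ltr01.
- by move=> m1 m2; apply: expmx_gt0D.
rewrite gcd1 => loopK; split=> //.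
pose m := (\sum_i p i + K.+1 + \sum_j q j)%N.
exists m => [|i j]; first by rewrite /m addnS.
have -> : m = (p i + (\sum_(k | k != i) p k + K.+1 + \sum_(k | k != j) q k)
                 + q j)%N.
  rewrite /m (bigD1 i) //= [(\sum_k q k)%N](bigD1 j) //=.
  by rewrite -!addnA (addnC (q j)).
apply: expmx_gt0D (fromO j); apply: expmx_gt0D (toO i) _.
by apply: loopK; rewrite ?dvd1n // addnAC (leq_trans (leqnSn K)) ?leq_addl.
Qed.

End NonnegativeMatrix.

(* The index 0 is harmless, being neutral for the gcd. *)
Definition support_gcd (N : nat) (b : nat -> bool) : nat :=
  \big[gcdn/0%N]_(j < N.+1 | b j) j.

Lemma dvdn_support_gcdP d N (b : nat -> bool) :
  reflect (forall j, (1 <= j <= N)%N -> b j -> (d %| j)%N)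
          (d %| support_gcd N b)%N.
Proof.
apply: (iffP (dvdn_biggcdP _ _ _)) => [db j /andP[_ jN] bj|db [[|j] jN] //].
  exact: (db (Ordinal (jN : j < N.+1)%N)).
exact: db.
Qed.

Lemma support_gcd_eq1P N (b : nat -> bool) :
  support_gcd N b = 1%N <->
  ~ (exists2 d, (1 < d)%N & forall j, (1 <= j <= N)%N -> b j -> (d %| j)%N).
Proof.
split=> [g1 [d d1 /dvdn_support_gcdP]|ncd].
  by rewrite g1 dvdn1 => /eqP dE; rewrite dE in d1.
case gE: (support_gcd N b) => [|[|g]] //; case: ncd.
  by exists 2%N => //; apply/dvdn_support_gcdP; rewrite gE.
by exists g.+2 => //; apply/dvdn_support_gcdP; rewrite gE.
Qed.

Lemma support_gcd_dvdn N (b : nat -> bool) j :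
  (1 <= j <= N)%N -> b j -> (support_gcd N b %| j)%N.
Proof. by apply/dvdn_support_gcdP: j. Qed.

Definition contract (b : nat -> bool) (d : nat) : nat -> bool :=
  fun k => b (k * d)%N.

Lemma support_gcd_contract M b d :
  (0 < d)%N -> (d %| support_gcd (M * d) b)%N ->
  support_gcd (M * d) b = (support_gcd M (contract b d) * d)%N.
Proof.
move=> d0 d_dvd; apply/eqP; rewrite eqn_dvd; apply/andP; split.
  have /dvdnP[e gE] := d_dvd.
  rewrite gE dvdn_pmul2r //; apply/dvdn_support_gcdP => k /andP[k0 kM] bk.
  rewrite -(dvdn_pmul2r d0) -gE support_gcd_dvdn //.
  by rewrite muln_gt0 k0 d0 leq_mul2r kM orbT.
apply/dvdn_support_gcdP => j jM bj.
have /dvdnP[k jE] := dvdn_trans d_dvd (support_gcd_dvdn jM bj).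
move: jM bj; rewrite jE muln_gt0 d0 andbT leq_pmul2r // => kM bk.
by rewrite dvdn_pmul2r // support_gcd_dvdn.
Qed.

Section SilverCompanion.
Variables (R : numDomainType) (N : nat) (b : nat -> bool).
Local Notation U := (silver_companion R N b).

Lemma silver_companion_ge0 i j : 0 <= U i j.
Proof. by rewrite mxE; case: ifP; rewrite ler0n. Qed.

Lemma silver_companion_gt0 (i j : 'I_N) :
  (0 < U i j) = if (i == 0 :> nat)%N then b j.+1 else (i == j.+1 :> nat).
Proof. by rewrite mxE; case: ifP => _; rewrite ltr0n lt0b. Qed.

Lemma silver_companion_graded : graded_mx (support_gcd N b) (@nat_of_ord N) U.
Proof.
move=> i j Uij; have : 0 < U i j by rewrite lt0r Uij silver_companion_ge0.
rewrite silver_companion_gt0; case: eqP => [->|_ /eqP-> //] bj.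
by rewrite mod0n; apply/esym/eqP; apply: support_gcd_dvdn bj; apply: ltn_ord.
Qed.

Lemma expmx_companion_descent k (i j : 'I_N) :
  i = (j + k)%N :> nat -> 0 < (U ^+ k) i j.
Proof.
elim: k i => [|k IHk] i ijk.
  by rewrite expr0 mxE -val_eqE /= ijk addn0 eqxx ltr01.
have jkN : (j + k < N)%N by rewrite (leq_trans _ (ltn_ord i)) // ijk addnS.
rewrite -[k.+1]add1n.
apply: (expmx_gt0D silver_companion_ge0 (k := Ordinal jkN)); last exact: IHk.
by rewrite expr1 silver_companion_gt0 /= ijk addnS eqxx.
Qed.

Lemma expmx_companion_jump l (o j : 'I_N) : o = 0%N :> nat ->
  (j < l <= N)%N -> b l -> 0 < (U ^+ (l - j)) o j.
Proof.
case: l => // l o0 /andP[jl lN] bl; rewrite subSn // -add1n.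
apply: (expmx_gt0D silver_companion_ge0 (k := Ordinal lN)).
  by rewrite expr1 silver_companion_gt0 o0.
by apply: expmx_companion_descent; rewrite /= subnKC.
Qed.

End SilverCompanion.

Lemma primitive_silver_companionP (R : numDomainType) N (b : nat -> bool) :
  (0 < N)%N -> b N ->
  primitive_mx (silver_companion R N b) <-> support_gcd N b = 1%N.
Proof.
case: N => // N _ bN; split=> [prim|gcd1].
  exact: primitive_graded_mx prim (@silver_companion_graded _ _ _).
have U_ge0 := @silver_companion_ge0 R N.+1 b.
apply: (primitive_mx_coprime_loops U_ge0 (o := ord0)) gcd1.
- by move=> i; exists i; apply: expmx_companion_descent.
- move=> j; exists (N.+1 - j)%N.
  by apply: expmx_companion_jump; rewrite ?ltn_ord /=.
case=> -[|l] lN bl; first by rewrite expr0 mxE eqxx ltr01.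
by rewrite /= -[l.+1]subn0; apply: (@expmx_companion_jump _ _ _ _ _ ord0).
Qed.

Lemma silverP N (b : nat -> bool) :
  reflect (b N /\ exists2 j, (0 < j < N)%N & b j) (silver N b).
Proof.
rewrite /silver; case: N => [|N].
  by constructor=> -[_ [j]]; rewrite ltn0 andbF.
rewrite big_nat_recr //=; case bN: (b N.+1); last first.
  by rewrite andbF; constructor=> -[].
rewrite addn1 !ltnS !lt0n sum_nat_seq_neq0.
apply: (iffP andP) => [[_ /hasP[j]]|[_ [j jN bj]]].
  by rewrite mem_index_iota /= eqb0 negbK => jN bj; split=> //; exists j.
split; first by case: j jN {bj} => // j; case: N {bN}.
by apply/hasP; exists j; rewrite ?mem_index_iota //= eqb0 negbK.
Qed.

Lemma silver_contract M b d :
  (0 < d)%N -> (d %| support_gcd (M * d) b)%N ->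
  silver (M * d) b -> silver M (contract b d).
Proof.
move=> d0 /dvdn_support_gcdP db /silverP[bM [j /andP[j0 jM] bj]].
apply/silverP; split=> //.
have /dvdnP[k jE] : (d %| j)%N by apply: db => //; rewrite j0 ltnW.
exists k; last by rewrite /contract -jE.
by move: j0 jM; rewrite jE muln_gt0 d0 andbT ltn_pmul2r // => -> ->.
Qed.

Section SilverPolynomial.
Variable R : nzRingType.

Lemma silver_polyE N b :
  silver_poly R N b = 'X^N - \poly_(i < N) (b (N - i)%N)%:R.
Proof.
rewrite /silver_poly big_rev_mkord poly_def subn1 /=; congr (_ - _).
by apply: eq_bigr => i _; rewrite subSS subKn ?(ltnW (ltn_ord i)).
Qed.

Lemma coef_silver_poly N b i :
  (silver_poly R N b)`_i = (i == N)%:R - ((i < N)%N && b (N - i)%N)%:R.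
Proof. by rewrite silver_polyE coefB coefXn coef_poly; case: ltnP. Qed.

Lemma silver_poly_contract M b d :
  (0 < d)%N -> (d %| support_gcd (M * d) b)%N ->
  silver_poly R (M * d) b = silver_poly R M (contract b d) \Po 'X^d.
Proof.
move=> d0 /dvdn_support_gcdP db; apply/polyP => i.
rewrite coef_comp_poly_Xn // !coef_silver_poly.
have [/dvdnP[k ->]|ndi] := boolP (d %| i)%N.
  by rewrite mulnK // eqn_pmul2r // ltn_pmul2r // /contract mulnBl.
have -> : (i == M * d)%N = false.
  by apply: contraNF ndi => /eqP->; apply: dvdn_mull.
rewrite sub0r; case: andP => [[iM bi]|_]; last by rewrite oppr0.
case/negP: ndi; rewrite -(dvdn_subr (ltnW iM)) ?dvdn_mull //.
by apply: db bi; rewrite subn_gt0 iM leq_subr.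
Qed.

Lemma silver_poly_comp_Xn_dvd N b d (q : {poly R}) :
  (0 < d)%N -> silver_poly R N b = q \Po 'X^d -> (d %| support_gcd N b)%N.
Proof.
move=> d0 Pq; have coef_dvd i : (silver_poly R N b)`_i != 0 -> (d %| i)%N.
  by rewrite Pq coef_comp_poly_Xn //; case: ifP; rewrite ?eqxx.
apply/dvdn_support_gcdP => j /andP[j0 jN] bj.
have dN : (d %| N)%N.
  by apply: coef_dvd; rewrite coef_silver_poly eqxx ltnn subr0 oner_eq0.
have NjN : (N - j < N)%N by rewrite ltn_subrL j0 (leq_trans j0).
rewrite -(dvdn_subr jN dN); apply: coef_dvd.
by rewrite coef_silver_poly ltn_eqF // NjN subKn // bj sub0r oppr_eq0 oner_eq0.
Qed.

End SilverPolynomial.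

Lemma imprimitive_silver_companionP (R : numDomainType) N b :
  silver N b ->
  ~ primitive_mx (silver_companion R N b) <->
  exists d M c,
    [/\ (1 < d)%N, silver M c, primitive_mx (silver_companion R M c) &
        silver_poly R N b = silver_poly R M c \Po 'X^d].
Proof.
have primP M c : silver M c ->
    primitive_mx (silver_companion R M c) <-> support_gcd M c = 1%N.
  by case/and3P=> /ltnW M0 cM _; apply: primitive_silver_companionP.
move=> hP; rewrite (primP _ _ hP).
split=> [g1|[d [M [c [d1 _ _ PQ]]]] g1]; last first.
  by have := silver_poly_comp_Xn_dvd (ltnW d1) PQ; rewrite g1 dvdn1 gtn_eqF.
have [/ltnW N0 bN _] := and3P hP.
set g := support_gcd N b in g1 *.
have gN : (g %| N)%N by rewrite support_gcd_dvdn // N0 /=.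
have g0 := dvdn_gt0 N0 gN; have /dvdnP[M NE] := gN.
have g_dvd : (g %| support_gcd (M * g) b)%N by rewrite -NE.
have hQ : silver M (contract b g).
  by apply: silver_contract g_dvd _; rewrite -?NE.
exists g, M, (contract b g); split=> //.
- by rewrite ltn_neqAle eq_sym g0 andbT; apply/eqP.
- apply/(primP _ _ hQ)/eqP; rewrite -(eqn_pmul2r g0) mul1n.
  by rewrite -support_gcd_contract // -NE.
- by rewrite {1}NE; apply: silver_poly_contract.
Qed.

(* If 0 < x <= 1, the nonzero coefficients b_N and b_j alone contribute
   1 + x^(N - j) > 1 >= x^N. *)
Lemma silver_pos_root_gt1 (R : realDomainType) N b (x : R) :
  silver N b -> 0 < x -> root (silver_poly R N b) x -> 1 < x.
Proof.
case/silverP=> bN [j /andP[j0 jN] bj] x0.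
rewrite /root silver_polyE !hornerE horner_poly subr_eq0 ltNge => /eqP xE.
apply/negP => x1; suff: x ^+ N > 1 by rewrite ltNge exprn_ile1 // ltW.
have N0 : (0 < N)%N by apply: leq_ltn_trans jN.
have NjN : (N - j < N)%N by rewrite ltn_subrL j0.
rewrite xE (bigD1 (Ordinal N0)) //= subn0 bN mulr1 ltrDl.
rewrite (bigD1 (Ordinal NjN)) -?val_eqE /= ?subn_eq0 -?ltnNge //.
rewrite subKn ?(ltnW jN) // bj mul1r ltr_pwDl ?exprn_gt0 //.
by rewrite sumr_ge0 // => i _; rewrite mulr_ge0 ?ler0n ?exprn_ge0 ?ltW.
Qed.

Lemma largest_pos_root_comp_Xn (R : rcfType) d (q : {poly R}) s : (0 < d)%N ->
  largest_pos_root (q \Po 'X^d) s -> largest_pos_root q (s ^+ d).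
Proof.
move=> d0 [s0 rs smax]; split; first by rewrite exprn_gt0.
  by move: rs; rewrite /root horner_comp hornerXn.
move=> x /(nth_root d.-1)[y y0]; rewrite prednK // => <- ry.
rewrite lerXn2r ?nnegrE ?(ltW y0) ?(ltW s0) // smax //.
by rewrite /root horner_comp hornerXn.
Qed.

Lemma exists_nontrivial_unity_root (C : numClosedFieldType) d : (1 < d)%N ->
  exists2 w : C, w != 1 & w ^+ d = 1.
Proof.
move=> d1; have d0 := ltnW d1.
exists (d.-root (-1) ^+ 2); last by rewrite exprAC rootCK // sqrrN expr1n.
rewrite sqrf_eq1 negb_or rootC_eq1 // lt_eqF ?(lt_trans (ltrN10 _)) //=.
by apply/eqP=> rE; have := rootC_lt0 (-1 : C) d1; rewrite rE ltrN10.
Qed.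

Lemma comp_Xn_second_root (C : numClosedFieldType) d (q : {poly C}) (z : C) :
  (1 < d)%N -> z != 0 -> root (q \Po 'X^d) z ->
  exists z', [/\ z' != z, root (q \Po 'X^d) z' & `|z'| = `|z|].
Proof.
move=> d1 z0 rz; have [w w1 wd] := exists_nontrivial_unity_root C d1.
have zwd : (z * w) ^+ d = z ^+ d by rewrite exprMn wd mulr1.
exists (z * w); split.
- by rewrite -[X in _ != X]mulr1 (inj_eq (mulfI z0)).
- by move: rz; rewrite /root !horner_comp !hornerXn zwd.
- by apply: (pexpIrn (ltnW d1)); rewrite ?nnegrE // -!normrX zwd.
Qed.

Lemma silver_comp_Xn_two_large_roots (R : rcfType) N b d (q : {poly R}) :
  silver N b -> (1 < d)%N -> silver_poly R N b = q \Po 'X^d ->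
  exists z1 z2 : R[i],
    [/\ z1 != z2,
        root (map_poly (real_complex R) (silver_poly R N b)) z1,
        root (map_poly (real_complex R) (silver_poly R N b)) z2,
        1 < `|z1| & 1 < `|z2|].
Proof.
move=> hP d1 Pq; have [s [s0 rs _]] := silver_number_exists R hP.
have s1 : 1 < `|s%:C%C|.
  by rewrite ger0_norm ?ler0c ?ltW // ltcR (silver_pos_root_gt1 hP).
have sC0 : s%:C%C != 0 by rewrite -normr_gt0 (lt_trans ltr01).
set P := map_poly _ _; have rsC : root P s%:C%C by apply: rmorph_root.
have PE : P = map_poly (real_complex R) q \Po 'X^d.
  by rewrite /P Pq map_comp_poly map_polyXn.
have := rsC; rewrite {1}PE => /(comp_Xn_second_root d1 sC0)[z [zs rz zE]].
by exists z, s%:C%C; split; rewrite ?zE // PE.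
Qed.

Theorem theorem4p1 (R : realType) (N : nat) (b : nat -> bool)
    (hP : silver N b) :
  (primitive_mx (silver_companion R N b) <->
     ~ (exists2 d : nat, (1 < d)%N &
          forall j : nat, (1 <= j <= N)%N -> b j -> (d %| j)%N)) /\
  ((~ primitive_mx (silver_companion R N b) <->
      exists (d M : nat) (c : nat -> bool),
        [/\ (1 < d)%N, silver M c, primitive_mx (silver_companion R M c) &
            silver_poly R N b = silver_poly R M c \Po 'X^d]) /\
   (forall (d M : nat) (c : nat -> bool),
      (1 < d)%N -> silver M c -> primitive_mx (silver_companion R M c) ->
      silver_poly R N b = silver_poly R M c \Po 'X^d ->
      (forall s : R, largest_pos_root (silver_poly R N b) s ->
         largest_pos_root (silver_poly R M c) (s ^+ d) /\
         silver_number (s ^+ d)) /\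
      (exists z1 z2 : R[i],
         [/\ z1 != z2,
             root (map_poly (real_complex R) (silver_poly R N b)) z1,
             root (map_poly (real_complex R) (silver_poly R N b)) z2,
             1 < `|z1| & 1 < `|z2|]))).
Proof.
have [/ltnW N0 bN _] := and3P hP.
split; first by rewrite primitive_silver_companionP // support_gcd_eq1P.
split=> [|d M c d1 hQ _ PQ]; first exact: imprimitive_silver_companionP.
split=> [s|]; last exact: silver_comp_Xn_two_large_roots hP d1 PQ.
rewrite PQ => /(largest_pos_root_comp_Xn (ltnW d1)) sQ.
by split=> //; exists M, c.
Qed.
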